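(* Let $(Y,S)=(\Sigma_2,\sigma)$, $(X,T)=(\Sigma_2\times\Sigma_2,\sigma\times\sigma)$, let $\pi:X\to Y$ be the first-coordinate projection, and let $$\mathrm{scl}_\alpha(t)=t^{\sqrt\alpha}\left(1+\log\tfrac1t\right)^{-\alpha},\qquad \alpha\ge0,\ t\in(0,1).$$ Then $$\overline h^C_{\mathrm{scl}}(T,X)=h^B_{\mathrm{scl}}(T,X)=4(\log2)^2,\qquad \overline h^C_{\mathrm{scl}}(S,Y)=h^B_{\mathrm{scl}}(S,Y)=(\log2)^2,$$ and every fiber $\pi^{-1}(y)$, $y\in Y$, satisfies $\overline h^C_{\mathrm{scl}}(T,\pi^{-1}(y))=h^B_{\mathrm{scl}}(T,\pi^{-1}(y))=(\log2)^2$. Consequently the two additive estimates $$\overline h^C_{\mathrm{scl}}(T,X)\le\overline h^C_{\mathrm{scl}}(S,Y)+\sup_{y\in Y}\overline h^C_{\mathrm{scl}}(T,\pi^{-1}(y)),\qquad h^B_{\mathrm{scl}}(T,X)\le h^B_{\mathrm{scl}}(S,Y)+\sup_{y\in Y}h^B_{\mathrm{scl}}(T,\pi^{-1}(y))$$ both fail, whereas $\overline h^C_{\mathrm{scl}}(T,X)=\Gamma_{\mathrm{scl}}(\overline h^C_{\mathrm{scl}}(S,Y),a_\pi)$ and $h^B_{\mathrm{scl}}(T,X)=\Gamma_{\mathrm{scl}}(h^B_{\mathrm{scl}}(S,Y),a_\pi)$.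
   Context: $(\Sigma_2,\sigma)$ is the one-sided full shift on $\{1,2\}^{\mathbb N}$ with the product topology. Quantities are computed with any compatible metric $d$ (they do not depend on the choice). For a system $(X,T)$ put $d_n(x,y)=\max_{0\le j<n}d(T^jx,T^jy)$ and $B_n(x,\epsilon)=\{y\in X: d_n(x,y)<\epsilon\}$; for $A\subset X$ non-empty, $r_n(A,\epsilon)$ is the minimal cardinality of a set $E\subset X$ with $A\subset\bigcup_{x\in E}B_n(x,\epsilon)$, and $s_n(A,\epsilon)$ is the maximal cardinality of a set $F\subset A$ with $d_n(x,y)\ge\epsilon$ for all distinct $x,y\in F$. Upper capacity entropy scale of a non-empty compact set $K\subset X$: $\overline\Lambda_{\mathrm{scl}_\alpha}(T,K)=\lim_{\epsilon\to0}\limsup_{n\to\infty}s_n(K,\epsilon)\,\mathrm{scl}_\alpha(e^{-n})$; $\overline h^C_{\mathrm{scl}}(T,K)=\inf\{\alpha>0:\overline\Lambda_{\mathrm{scl}_\alpha}(T,K)=0\}=\sup\{\alpha>0:\overline\Lambda_{\mathrm{scl}_\alpha}(T,K)=\infty\}$ ($\sup\emptyset=0$, $\inf\emptyset=+\infty$). Bowen entropy scale of a non-empty $K\subset X$: $M_{\mathrm{scl}_\alpha}(T,K,\epsilon,N)=\inf\sum_{i}\mathrm{scl}_\alpha(e^{-n_i})$, the infimum over finite or countable covers $\{B_{n_i}(x_i,\epsilon)\}_i$ of $K$ with $n_i\ge N$, $x_i\in X$; $M_{\mathrm{scl}_\alpha}(T,K)=\lim_{\epsilon\to0}\lim_{N\to\infty}M_{\mathrm{scl}_\alpha}(T,K,\epsilon,N)$;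 $h^B_{\mathrm{scl}}(T,K)=\sup\{\alpha>0:M_{\mathrm{scl}_\alpha}(T,K)=\infty\}=\inf\{\alpha>0:M_{\mathrm{scl}_\alpha}(T,K)=0\}$. $a_\pi=\sup_{y\in Y}h^U_{\mathrm{top}}(T,\pi^{-1}(y))$ where $h^U_{\mathrm{top}}(T,A)=\lim_{\epsilon\to0}\limsup_{n\to\infty}\frac1n\log r_n(A,\epsilon)$. For $u,a\in[0,+\infty)$, $\Gamma_{\mathrm{scl}}(u,a)=\inf\{\gamma>0:\exists\,\alpha>u,\tau>0\text{ such that }\limsup_{n\to\infty}e^{(a+\tau)n}\,\mathrm{scl}_\gamma(e^{-n})/\mathrm{scl}_\alpha(e^{-n})<+\infty\}$. *)

(* Defs.v *)
From HB Require Import structures.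
From mathcomp Require Import all_boot all_order all_algebra.
From mathcomp Require Import all_classical all_reals all_analysis.

Set Implicit Arguments.
Unset Strict Implicit.
Unset Printing Implicit Defensive.

Import Order.TTheory GRing.Theory Num.Theory.
Import numFieldNormedType.Exports.

Local Open Scope classical_set_scope.
Local Open Scope card_scope.
Local Open Scope ring_scope.

Definition is_metric (R : realType) (X : Type) (d : X -> X -> R) : Prop :=
  [/\ forall x y, 0 <= d x y,
      forall x y, d x y = 0 <-> x = y,
      forall x y, d x y = d y x &
      forall x y z, d x z <= d x y + d y z].

Definition compatible_metric (R : realType) (X : topologicalType)
    (d : X -> X -> R) : Prop :=
  is_metric d /\
  forall A : set X, open A <->
    (forall x, A x -> exists2 e : R, 0 < e & [set y | d x y < e] `<=` A).

(* The base value 0 of the big maximum only matters for n = 0. *)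
Definition dyn_dist (R : realType) (X : Type) (d : X -> X -> R) (T : X -> X)
    (n : nat) (x y : X) : R :=
  \big[Num.max/0]_(j < n) d (iter j T x) (iter j T y).

Definition dyn_ball (R : realType) (X : Type) (d : X -> X -> R) (T : X -> X)
    (n : nat) (x : X) (e : R) : set X :=
  [set y | dyn_dist d T n x y < e].

(* Cardinalities of spanning and separated sets are taken in \bar R, so that
   both counts are defined (possibly +oo) without compactness assumptions. *)
Definition span_num (R : realType) (X : Type) (d : X -> X -> R) (T : X -> X)
    (A : set X) (n : nat) (e : R) : \bar R :=
  ereal_inf [set m%:R%:E | m in [set m : nat | exists E : set X,
    E #= `I_m /\ A `<=` \bigcup_(x in E) dyn_ball d T n x e]].

Definition sep_num (R : realType) (X : Type) (d : X -> X -> R) (T : X -> X)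
    (A : set X) (n : nat) (e : R) : \bar R :=
  ereal_sup [set m%:R%:E | m in [set m : nat | exists F : set X,
    [/\ F #= `I_m, F `<=` A &
        forall x y, F x -> F y -> x <> y -> e <= dyn_dist d T n x y]]].

(* A scale is a family scl : R -> R -> R, with scl alpha t for scl_alpha(t). *)

Definition upper_capacity (R : realType) (scl : R -> R -> R) (X : Type)
    (d : X -> X -> R) (T : X -> X) (K : set X) (alpha : R) : \bar R :=
  lim ((limn_esup (fun n : nat =>
     (sep_num d T K n e * (scl alpha (expR (- n%:R)))%:E)%E)) @[e --> 0^'+]).

Definition hC (R : realType) (scl : R -> R -> R) (X : Type)
    (d : X -> X -> R) (T : X -> X) (K : set X) : \bar R :=
  ereal_inf [set alpha%:E | alpha in
    [set alpha : R | 0 < alpha /\ upper_capacity scl d T K alpha = 0%E]].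

(* Finite and countable covers are indexed by an arbitrary D : set nat. *)
Definition bowen_pre (R : realType) (scl : R -> R -> R) (X : Type)
    (d : X -> X -> R) (T : X -> X) (K : set X) (alpha e : R) (N : nat)
    : \bar R :=
  ereal_inf [set s : \bar R | exists (D : set nat) (x : nat -> X)
      (k : nat -> nat),
    [/\ forall i, D i -> (N <= k i)%N,
        K `<=` \bigcup_(i in D) dyn_ball d T (k i) (x i) e &
        s = \esum_(i in D) (scl alpha (expR (- (k i)%:R)))%:E]].

Definition bowen_measure (R : realType) (scl : R -> R -> R) (X : Type)
    (d : X -> X -> R) (T : X -> X) (K : set X) (alpha : R) : \bar R :=
  lim ((limn (fun N : nat => bowen_pre scl d T K alpha e N)) @[e --> 0^'+]).

(* Adjoining 0 implements the convention sup set0 = 0. *)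
Definition hB (R : realType) (scl : R -> R -> R) (X : Type)
    (d : X -> X -> R) (T : X -> X) (K : set X) : \bar R :=
  ereal_sup (0%E |` [set alpha%:E | alpha in
    [set alpha : R | 0 < alpha /\ bowen_measure scl d T K alpha = +oo%E]]).

Definition hU_top (R : realType) (X : Type) (d : X -> X -> R) (T : X -> X)
    (A : set X) : \bar R :=
  lim ((limn_esup (fun n : nat =>
     ((n%:R^-1)%:E * lne (span_num d T A n e))%E)) @[e --> 0^'+]).

Definition fiber (X Y : Type) (p : X -> Y) (y : Y) : set X := p @^-1` [set y].

Definition fiber_entropy (R : realType) (X Y : Type) (d : X -> X -> R)
    (T : X -> X) (p : X -> Y) : \bar R :=
  ereal_sup [set hU_top d T (fiber p y) | y in [set: Y]].

Definition Gamma (R : realType) (scl : R -> R -> R) (u a : R) : \bar R :=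
  ereal_inf [set gamma%:E | gamma in [set gamma : R | 0 < gamma /\
    exists alpha tau : R, [/\ u < alpha, 0 < tau &
      (limn_esup (fun n : nat =>
         (expR ((a + tau) * n%:R) * scl gamma (expR (- n%:R))
            / scl alpha (expR (- n%:R)))%:E) < +oo)%E]]].

(* cantor_space is bool^nat with the product topology; the two booleans play
   the role of the two symbols 1 and 2. *)
Definition Sigma2 : topologicalType := cantor_space.

Definition sigma (x : Sigma2) : Sigma2 := fun n => x n.+1.

Definition sigma_sigma (x : Sigma2 * Sigma2) : Sigma2 * Sigma2 :=
  (sigma x.1, sigma x.2).

Definition log_scale (R : realType) (alpha t : R) : R :=
  t `^ Num.sqrt alpha * (1 + ln t^-1) `^ (- alpha).

(* Main.v *)
(* Balls in the Bowen metrics d_n are squeezed between cylinders of length n + m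
   and n, with m depending only on the radius.  A set whose points are coded by
   binary sequences, n symbols of the system corresponding to r * n bits, thus has
   2 ^ (r n) separated points up to a constant, and Kraft's inequality bounds
   every cover by balls from below.  Since
     2 ^ (r n) scl_a(e ^ -n) = exp ((r log 2 - sqrt a) n - a log (1 + n)),
   the critical exponent is (r log 2) ^ 2 for both entropies.  Here r = 2 for the
   product (coordinates interlaced) and r = 1 for the base and the fibers.  It is the square
   roots of the exponents that add up, and Gamma (u, a) = (sqrt u + a) ^ 2. *)

Require Import Defs.
From HB Require Import structures.
From mathcomp Require Import all_boot all_order all_algebra.
From mathcomp Require Import all_classical all_reals all_analysis.
From mathcomp Require Import finmap zify ring lra.

Set Implicit Arguments.
Unset Strict Implicit.
Unset Printing Implicit Defensive.

Import Order.TTheory GRing.Theory Num.Theory.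
Import numFieldNormedType.Exports.

Local Open Scope classical_set_scope.
Local Open Scope card_scope.
Local Open Scope ring_scope.

(** * Growth of the logarithmic scale along exp(-n) *)

Lemma log_scale_expRN (R : realType) (a : R) (n : nat) :
  log_scale a (expR (- n%:R)) =
  expR (- Num.sqrt a * n%:R - a * ln (1 + n%:R)).
Proof.
rewrite /log_scale /powR !gt_eqF ?expR_gt0//; last first.
  by rewrite -expRN opprK expRK ltr_pwDl.
by rewrite -expRN opprK !expRK -expRD mulrN mulNr mulNr.
Qed.

(** Applying [ln y <= y] to [y = h * (1 + x)] puts the logarithm below a line of arbitrarily small
    slope [h]. *)
Lemma ln1D_le_linear (R : realType) (h x : R) : 0 < h -> 0 <= x ->
  ln (1 + x) <= h * x + (h - ln h).
Proof.
move=> h0 x0; have x1 : 0 < 1 + x by rewrite ltr_pwDl.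
have : ln (h * (1 + x)) <= h * (1 + x) by apply/ltW/ln_sublinear/mulr_gt0.
rewrite lnM ?posrE//; lra.
Qed.

Lemma near_expR_linear_ge (R : realType) (c p A : R) : 0 < c ->
  \forall n \near \oo, A <= expR (c * n%:R - p * ln (1 + n%:R)).
Proof.
(* Chosen so that [(|p| + 1) * h = c / 2]: up to a constant, the logarithm consumes at most half of
   the linear growth. The added 1 keeps the divisor positive when [p = 0]. *)
move=> c0; pose h := c / (2 * (`|p| + 1)).
have p1 : 0 < `|p| + 1 by rewrite ltr_wpDl.
have h0 : 0 < h by rewrite divr_gt0// mulr_gt0.
near=> n; set x : R := n%:R.
have x0 : 0 <= x by [].
have l0 : 0 <= ln (1 + x) by rewrite ln_ge0// lerDl.
have lle := ln1D_le_linear h0 x0.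
have ple : p * ln (1 + x) <= (`|p| + 1) * (h * x + (h - ln h)).
  apply: (@le_trans _ _ ((`|p| + 1) * ln (1 + x))); last by rewrite ler_pM2l.
  by rewrite ler_wpM2r// (le_trans (ler_norm p))// lerDl.
have hE : (`|p| + 1) * (h * x) = c / 2 * x.
  by rewrite /h; field; rewrite gt_eqF.
apply: le_trans (expR_ge1Dx _).
have : 2 / c * (A + (`|p| + 1) * (h - ln h)) <= x.
  by rewrite /x; near: n; apply: nbhs_infty_ger.
rewrite -(ler_pM2l (_ : 0 < c / 2)) ?divr_gt0// mulrA (_ : c / 2 * (2 / c) = 1);
  last by field; rewrite gt_eqF.
move: ple; rewrite mulrDr hE; lra.
Unshelve. all: by end_near. Qed.

(** When [c = 0] the logarithmic term alone forces the decay; this case settles the critical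
    exponent itself. *)
Lemma near_expR_linear_le (R : realType) (c p d : R) :
  c <= 0 -> 0 < p -> 0 < d ->
  \forall n \near \oo, expR (c * n%:R - p * ln (1 + n%:R)) <= d.
Proof.
move=> c0 p0 d0; near=> n; set x : R := n%:R.
have x0 : 0 <= x by [].
rewrite -[leRHS]lnK ?posrE// ler_expR.
have cx : c * x <= 0 by rewrite mulr_le0_ge0.
suff : - ln d / p <= ln (1 + x).
  rewrite ler_pdivrMr//; lra.
rewrite -[leLHS]expRK ler_ln ?posrE ?expR_gt0 ?ltr_pwDl//.
suff : expR (- ln d / p) <= x by lra.
by rewrite /x; near: n; apply: nbhs_infty_ger.
Unshelve. all: by end_near. Qed.

(** * Cardinalities through injections *)

Lemma card_range_inj (I : finType) (T : Type) (h : I -> T) :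
  injective h -> range h #= `I_#|I|.
Proof.
move=> hinj.
apply: (card_eq_trans (inj_card_eq _)); first by move=> x y _ _; apply: hinj.
apply/card_set_bijP; exists (fun i : I => enum_rank i : nat); split.
- by move=> i _ /=.
- by move=> i j _ _ /val_inj /enum_rank_inj.
- by move=> k /= kI; exists (enum_val (Ordinal kI)); rewrite ?enum_valK.
Qed.

Lemma card_geI (I : finType) (T : Type) (F : set T) (m : nat) (h : I -> T) :
  F #= `I_m -> injective h -> (forall i, F (h i)) -> (#|I| <= m)%N.
Proof.
move=> /card_set_bijP[f [fm finj _]] hinj hF.
have fh i : (f (h i) < m)%N by apply: fm.
rewrite -[leqRHS]card_ord; apply: (@leq_card _ _ (fun i => Ordinal (fh i))).
by move=> i j /(congr1 val)/= /finj fij; apply/hinj/fij; exact: mem_set.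
Qed.

Lemma card_leI (I : finType) (T : Type) (F : set T) (m : nat) (h : T -> I) :
  F #= `I_m -> {in F &, injective h} -> (m <= #|I|)%N.
Proof.
move=> /card_set_bijP[f [_ _ fsurj]] hinj.
have /choice[g gP] (k : 'I_m) : exists x, F x /\ f x = k.
  by have [|x Fx fx] := fsurj k; [exact: ltn_ord|exists x].
rewrite -[leqLHS]card_ord; apply: (@leq_card _ _ (h \o g)) => i j /= hij.
have [Fi fi] := gP i; have [Fj fj] := gP j; apply/ord_inj.
by rewrite -fi -fj; congr f; apply: hinj => //; exact: mem_set.
Qed.

(** * Words and the finite Kraft inequality *)

Definition word (n : nat) (w : Sigma2) : n.-tuple bool :=
  [tuple w i | i < n].

(** The default value of [nth] continues the word by [false], which selects one point in each
    cylinder. *)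
Definition pad (n : nat) (t : n.-tuple bool) : Sigma2 := nth false t.

Lemma wordP (n : nat) (w w' : Sigma2) :
  word n w = word n w' <-> forall i, (i < n)%N -> w i = w' i.
Proof.
split=> [ww' i ni|ww']; last by apply: eq_from_tnth => i; rewrite !tnth_mktuple ww'.
by have := congr1 (fun t : n.-tuple bool => tnth t (Ordinal ni)) ww'; rewrite !tnth_mktuple.
Qed.

Lemma word_pad (n : nat) (t : n.-tuple bool) : word n (pad t) = t.
Proof. by apply: eq_from_tnth => i; rewrite tnth_mktuple (tnth_nth false). Qed.

Lemma card_word (n : nat) : #|{: n.-tuple bool}| = (2 ^ n)%N.
Proof. by rewrite card_tuple card_bool. Qed.

(** Once the first [k] letters are prescribed, the remaining [n - k] determine the word. *)
Lemma card_word_prefix (n k : nat) (v : Sigma2) : (k <= n)%N ->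
  (#|[pred t : n.-tuple bool | word k (pad t) == word k v]| <= 2 ^ (n - k))%N.
Proof.
move=> kn; rewrite -card_word.
pose g (t : n.-tuple bool) := word (n - k) (fun i => pad t (k + i)%N).
apply: (@leq_card_in _ _ g) => s t; rewrite !inE => /eqP sv /eqP tv st.
rewrite -[s]word_pad -[t]word_pad; apply/wordP => i ni.
have [ik|ki] := ltnP i k; first by have /wordP/(_ _ ik) := etrans sv (esym tv).
have /wordP/(_ (i - k)%N) := st; rewrite /= subnKC//; apply.
by rewrite ltn_sub2r// (leq_ltn_trans ki).
Qed.

(** Count words of length [n], the largest [l i]: each of the [2 ^ n] words lies in some cylinder,
    and cylinder [i] holds at most [2 ^ (n - l i)] of them. *)
Lemma kraft_fset (R : realType) (D : {fset nat}) (l : nat -> nat)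
    (v : nat -> Sigma2) :
  (forall w, exists2 i, i \in D & word (l i) w = word (l i) (v i)) ->
  1 <= \sum_(i <- D) (2 ^- l i : R).
Proof.
move=> cov; pose n := \max_(i <- D) l i.
have ln i : i \in D -> (l i <= n)%N by move=> iD; rewrite /n; apply: leq_bigmax_seq.
have : (2 ^ n <= \sum_(i <- D) 2 ^ (n - l i))%N.
  pose P i (t : n.-tuple bool) := word (l i) (pad t) == word (l i) (v i).
  apply: (@leq_trans (\sum_(i <- D) #|[pred t : n.-tuple bool | P i t]|)%N).
    (* Double counting: after exchanging the sums over cylinders and words, each word contributes at
       least 1. *)
    under eq_bigr => i _ do rewrite -sum1_card big_mkcond.
    rewrite exchange_big/= -card_word -sum1_card; apply: leq_sum => t _.
    have [i iD /eqP ti] := cov (pad t).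
    by rewrite (big_rem i iD)/= inE /P ti.
  by rewrite big_seq [leqRHS]big_seq; apply: leq_sum => i iD; apply/card_word_prefix/ln.
have p0 : 0 < 2 ^+ n :> R by rewrite exprn_gt0.
rewrite -(ler_nat R) natr_sum natrX -[leLHS]mulr1 => h.
rewrite -(ler_pM2l p0) (le_trans h)// mulr_sumr big_seq [leRHS]big_seq.
apply: ler_sum => i iD; rewrite natrX -{2}(subnK (ln _ iD)) exprD mulfK//.
Qed.

(** * Cylinders in the topology of the Cantor space *)

Lemma near_word (n : nat) (w : Sigma2) :
  \forall w' \near w, word n w' = word n w.
Proof.
suff : \forall w' \near w, forall i, (i < n)%N -> w' i = w i.
  by apply: filterS => w' /wordP.
elim: n => [|n IH]; first by near=> w'.
have wn : \forall w' \near w, w' n = w n.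
  pose cn := @proj_continuous nat (fun=> bool : topologicalType) n w [set w n].
  by apply: cn; exact: discrete_set1.
near=> w' => i; rewrite ltnS leq_eqVlt => /predU1P[->|ni].
  by near: w'.
by move: i ni; near: w'.
Unshelve. all: by end_near. Qed.

Lemma open_word (n : nat) (u : n.-tuple bool) :
  open [set w : Sigma2 | word n w = u].
Proof.
rewrite openE => w /= <-; exact: near_word.
Qed.

(** Otherwise points outside [U] sharing ever longer prefixes with [w] would converge to [w]. *)
Lemma nbhs_word (w : Sigma2) (U : set Sigma2) : nbhs w U ->
  exists n, forall w', word n w' = word n w -> U w'.
Proof.
move=> Uw; apply: contrapT => nE.
have /choice[g gP] n : exists w', word n w' = word n w /\ ~ U w'.
  apply: contrapT => nE'; apply: nE; exists n => w' ww'.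
  by apply: contrapT => nU; apply: nE'; exists w'.
suff gw : g @ \oo --> w.
  by have [N _ /(_ N (leqnn N))] := gw _ Uw; have [] := gP N.
(* Convergence in the product topology is tested on each coordinate [N], where [g i] agrees with [w]
   as soon as [i > N]. *)
apply/cvg_sup => N V [W] [[Z] oZ <-] ZwN ZV.
apply: (filterS ZV); rewrite nbhs_simpl; exists N.+1 => // i /= Ni; have [/wordP/(_ _ Ni) giN _] := gP i.
by rewrite giN.
Qed.

(** Cylinders are open, so compactness reduces a countable cover to a finite one. *)
Lemma kraft (R : realType) (D : set nat) (l : nat -> nat)
    (v : nat -> Sigma2) :
  (forall w, exists2 i, D i & word (l i) w = word (l i) (v i)) ->
  exists2 D' : {fset nat}, [set` D'] `<=` D & 1 <= \sum_(i <- D') (2 ^- l i : R).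
Proof.
move=> cov; have := cantor_space_compact; rewrite compact_cover.
move=> /(_ nat D (fun i => [set w : Sigma2 | word (l i) w = word (l i) (v i)])).
case=> [i _|w _|D' D'D covD']; first exact: open_word.
  by have [i] := cov w; exists i.
exists D'; first by move=> i /= /D'D/set_mem.
by apply: (@kraft_fset _ _ _ v) => w; have [//|i] := covD' w; exists i.
Qed.

(** * Compatible metrics on a compact space *)

Lemma compact_finite_cover (X : ptopologicalType) (O : X -> set X) :
  compact [set: X] -> (forall x, open (O x)) -> (forall x, O x x) ->
  exists D : {fset X}, forall y, exists2 x, x \in D & O x y.
Proof.
rewrite compact_cover => cX oO Ox.
have [//|x _|D _ covD] := cX X [set: X] O; first by exists x.
by exists D => y; have [//|x] := covD y; exists x.
Qed.

Section compact_metric.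
Variables (R : realType) (X : ptopologicalType) (d : X -> X -> R).
(** The model for [E n] is agreement of the first [n] symbols. [metric_refines] and [metric_refined]
    together say that these relations and [d] generate the same uniformity. *)
Variable E : nat -> X -> X -> Prop.
Hypothesis cX : compact [set: X].
Hypothesis dX : compatible_metric d.
Hypothesis Esym : forall n x y, E n x y -> E n y x.
Hypothesis Etrans : forall n x y z, E n x y -> E n y z -> E n x z.
Hypothesis Ele : forall m n x y, (m <= n)%N -> E n x y -> E m x y.
Hypothesis Enear : forall n x, \forall y \near x, E n x y.
Hypothesis Ebasis : forall x (U : set X), nbhs x U ->
  exists n, forall y, E n x y -> U y.

Let open_ball_metric x e : open [set y | d x y < e].
Proof.
case: dX => -[_ _ _ dtri] oP; apply/oP => y /= xy; exists (e - d x y).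
  by rewrite subr_gt0.
by move=> z /= yz; rewrite (le_lt_trans (dtri _ y _))// -ltrBrDl.
Qed.

Let open_E n x : open [set y | E n x y].
Proof.
rewrite openE => y /= xy; near=> z; apply: (Etrans xy).
by near: z; exact: Enear.
Unshelve. all: by end_near. Qed.

(** A Lebesgue number argument: with half radii in a finite subcover, two close points lie in one
    full ball, hence in one class. *)
Lemma metric_refines n : exists2 e, 0 < e & forall x y, d x y < e -> E n x y.
Proof.
case: (dX) => -[_ d0 dC dtri] oP.
have /choice[r rP] x : exists e, 0 < e /\ forall y, d x y < e -> E n x y.
  have [] := (oP [set y | E n x y]).1 (open_E n x) x; last by move=> e e0 h; exists e.
  by have /nbhs_singleton := Enear n x.
have [||D DP] := @compact_finite_cover X (fun x => [set y | d x y < r x / 2]) cX.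
- by move=> x; exact: open_ball_metric.
- by move=> x /=; rewrite (d0 x x).2// divr_gt0//; have [] := rP x.
exists (\big[Num.min/1]_(x <- D) (r x / 2)).
  by rewrite lt_bigmin// => x _; rewrite divr_gt0//; have [] := rP x.
move=> y z yz; have [x xD /= xy] := DP y; have [r0 rE] := rP x.
apply: (Etrans (Esym (rE y _)) (rE z _)).
  by rewrite (lt_trans xy)// ltr_pdivrMr// ltr_pMr// ltr1n.
rewrite (le_lt_trans (dtri _ y _))// [ltRHS]splitr ltrD//.
by rewrite (lt_le_trans yz)// ge_bigmin_seq.
Qed.

(** The same compactness argument with the roles exchanged: the largest index of a finite subcover
    by classes works, and [e / 2] serves the triangle inequality through the centre. *)
Lemma metric_refined e : 0 < e -> exists m, forall x y, E m x y -> d x y < e.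
Proof.
case: (dX) => -[_ d0 dC dtri] oP e0.
have /choice[r rP] x : exists n, forall y, E n x y -> d x y < e / 2.
  apply: (Ebasis (U := [set y | d x y < e / 2])).
  apply: open_nbhs_nbhs; split; first exact: open_ball_metric.
  by rewrite /= (d0 x x).2// divr_gt0.
have [||D DP] := @compact_finite_cover X (fun x => [set y | E (r x) x y]) cX.
- by move=> x; exact: open_E.
- by move=> x; have /nbhs_singleton := Enear (r x) x.
exists (\max_(x <- D) r x) => y z yz; have [x xD /= xy] := DP y.
have xz : E (r x) x z by apply/(Etrans xy)/(Ele _ yz)/leq_bigmax_seq.
by rewrite (le_lt_trans (dtri _ x _))// [ltRHS]splitr ltrD ?(dC y) ?rP.
Qed.

End compact_metric.

(** * Upper limits of extended real sequences *)

Lemma limn_esup_le_near (R : realType) (u : nat -> \bar R) (l : \bar R) :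
  (\forall n \near \oo, (u n <= l)%E) -> (limn_esup u <= l)%E.
Proof.
move=> ul; apply: ge_ereal_inf.
exists (ereal_sup (u @` [set n | (u n <= l)%E])); first by exists [set n | (u n <= l)%E].
by apply/ereal_supP => _ [n /= unl <-].
Qed.

Lemma limn_esup_ge_near (R : realType) (u : nat -> \bar R) (l : \bar R) :
  (\forall n \near \oo, (l <= u n)%E) -> (l <= limn_esup u)%E.
Proof.
move=> ul; apply/ereal_infP => _ [V Voo <-].
have [n [Vn lun]] := filter_ex (filterI Voo ul).
by apply: le_ereal_sup_tmp; exists (u n) => //; exists n.
Qed.

Lemma limn_esup0 (R : realType) (u : nat -> \bar R) :
  (forall n, (0 <= u n)%E) ->
  (forall d : R, 0 < d -> \forall n \near \oo, (u n <= d%:E)%E) ->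
  limn_esup u = 0%E.
Proof.
move=> u0 ud; apply/le_anti/andP; split; last first.
  by apply: limn_esup_ge_near; apply: nearW.
apply/lee_addgt0Pr => d d0; rewrite add0e.
exact/limn_esup_le_near/ud.
Qed.

Lemma limn_esupy (R : realType) (u : nat -> \bar R) :
  (forall A : R, \forall n \near \oo, (A%:E <= u n)%E) -> limn_esup u = +oo%E.
Proof. by move=> /cvgeyPge /cvg_limn_einf_sup[]. Qed.

(** * Systems coded by binary sequences *)

Lemma pow2_log_scale (R : realType) (r n : nat) (a : R) :
  (2 ^ (r * n))%:R * log_scale a (expR (- n%:R)) =
  expR ((r%:R * ln 2 - Num.sqrt a) * n%:R - a * ln (1 + n%:R)).
Proof.
rewrite log_scale_expRN natrX -{1}[2]lnK ?posrE// -expRM_natl -expRD natrM.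
by congr expR; ring.
Qed.

Lemma log_scale_gt0 (R : realType) (a : R) (n : nat) :
  0 < log_scale a (expR (- n%:R)).
Proof. by rewrite log_scale_expRN expR_gt0. Qed.

(** Membership in a common cylinder of length [n] for the partition into level sets of [g]. *)
Definition same_itinerary (X A : Type) (g : X -> A) (T : X -> X) (n : nat)
    (x y : X) : Prop :=
  forall j, (j < n)%N -> g (iter j T x) = g (iter j T y).

Section coded_system.
Variables (R : realType) (X A : Type) (g : X -> A) (T : X -> X).
Variables (d : X -> X -> R) (e0 : R).
Local Notation E := (same_itinerary g T).
Hypothesis e0_gt0 : 0 < e0.
Hypothesis dg : forall x y, d x y < e0 -> g x = g y.
Hypothesis gd : forall e, 0 < e -> exists m, forall x y, E m x y -> d x y < e.
(** [f] codes [K] with [r] bits per unit of time. [K] is a mere subset, so that fibers fit: [T]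
    sends the fiber over [y] into the one over [sigma y]. *)
Variables (K : set X) (f : Sigma2 -> X) (r : nat).
Hypothesis r_gt0 : (0 < r)%N.
Hypothesis Kf : K = range f.
Hypothesis Ef : forall n w w',
  E n (f w) (f w') <-> word (r * n) w = word (r * n) w'.

Let Esym n x y : E n x y -> E n y x.
Proof. by move=> xy j jn; rewrite xy. Qed.

Let Etrans n x y z : E n x y -> E n y z -> E n x z.
Proof. by move=> xy yz j jn; rewrite xy// yz. Qed.

Lemma dyn_dist_itinerary n x y e : e <= e0 ->
  dyn_dist d T n x y < e -> E n x y.
Proof.
move=> ee0 xy j jn; apply: dg; apply: (lt_le_trans _ ee0).
apply: le_lt_trans xy.
by rewrite /dyn_dist (le_bigmax _ (fun j : 'I_n => d (iter j T x) (iter j T y)) (Ordinal jn)).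
Qed.

Lemma itinerary_dyn_dist e : 0 < e ->
  exists m, forall n x y, E (n + m) x y -> dyn_dist d T n x y < e.
Proof.
move=> /[dup] epos /gd[m mP]; exists m => n x y xy.
(* At each time [j < n] the two orbits still share [m] symbols. Positivity of [e] handles the base
   value 0 of the maximum. *)
apply/bigmax_ltP; split => // j _; apply: mP => k km.
by rewrite -!iterD; apply: xy; rewrite addnC -addnS leq_add// ltnW.
Qed.

(** Choose one point per word: points of distinct cylinders are at distance at least [e0] at some
    time before [n]. *)
Lemma sep_num_ge n e : e <= e0 -> ((2 ^ (r * n))%:R%:E <= sep_num d T K n e)%E.
Proof.
move=> ee0; pose h (t : (r * n).-tuple bool) := f (pad t).
have hE t t' : E n (h t) (h t') -> t = t' by move=> /Ef; rewrite !word_pad.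
apply: ereal_sup_ubound; exists (2 ^ (r * n))%N => //=; exists (range h); split.
- rewrite -(card_word (r * n)); apply: card_range_inj => t t' tt'.
  by apply: hE; rewrite tt'.
- by move=> _ [t _ <-]; rewrite Kf; exists (pad t).
- move=> _ _ [t _ <-] [t' _ <-] tt'; rewrite leNgt; apply/negP.
  by move=> /(dyn_dist_itinerary ee0)/hE tE; apply: tt'; rewrite tE.
Qed.

Lemma sep_num_le n e m : (forall x y, E (n + m) x y -> dyn_dist d T n x y < e) ->
  (sep_num d T K n e <= (2 ^ (r * (n + m)))%:R%:E)%E.
Proof.
move=> Em; apply/ereal_supP => _ [k [F [Fk FK Fsep]] <-].
rewrite lee_fin ler_nat -card_word.
(* [h] inverts [f] on [F]; its value elsewhere is arbitrary. *)
have /choice[h hP] x : exists w, F x -> f w = x.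
  have [Fx|nFx] := pselect (F x); last by exists (fun=> false).
  by have := FK _ Fx; rewrite Kf => -[w _ fw]; exists w.
apply: (card_leI (h := fun x => word (r * (n + m)) (h x)) Fk).
move=> x y /set_mem Fx /set_mem Fy /Ef; rewrite !hP// => /Em xy.
by apply: contrapT => /(Fsep _ _ Fx Fy); rewrite leNgt xy.
Qed.

(** A ball meets only one cylinder, so distinct words need distinct centres. A centre may lie
    outside [K], hence the comparison by itineraries rather than by codes. *)
Lemma span_num_ge n e : e <= e0 ->
  ((2 ^ (r * n))%:R%:E <= span_num d T K n e)%E.
Proof.
move=> ee0; apply/ereal_infP => _ [k [F [Fk FK]] <-].
rewrite lee_fin ler_nat -card_word.
have /choice[h hP] (t : (r * n).-tuple bool) :
    exists x, F x /\ dyn_dist d T n x (f (pad t)) < e.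
  have [|x Fx xt] := FK (f (pad t)); first by rewrite Kf; exists (pad t).
  by exists x.
apply: (card_geI Fk (h := h)) => [t t' tt'|t]; last by have [] := hP t.
have [_ ht] := hP t; have [_ ht'] := hP t'.
rewrite -[t]word_pad -[t']word_pad; apply/Ef.
apply: Etrans (dyn_dist_itinerary ee0 ht'); apply: Esym.
by rewrite -tt'; apply: dyn_dist_itinerary ht.
Qed.

Lemma span_num_le n e m : (forall x y, E (n + m) x y -> dyn_dist d T n x y < e) ->
  (span_num d T K n e <= (2 ^ (r * (n + m)))%:R%:E)%E.
Proof.
move=> Em; pose h (t : (r * (n + m)).-tuple bool) := f (pad t).
apply: ereal_inf_lbound; exists (2 ^ (r * (n + m)))%N => //; exists (range h); split.
  rewrite -(card_word (r * (n + m))); apply: card_range_inj => t t' tt'.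
  have /Ef : E (n + m) (f (pad t)) (f (pad t')) by rewrite -/(h t) tt'.
  by rewrite !word_pad.
rewrite Kf => _ [w _ <-]; exists (h (word _ w)); first by exists (word _ w).
by apply/Em/Ef; rewrite word_pad.
Qed.

(** The cover uses one ball for each word of length [r * (n + m)], all at the same time [n]. *)
Lemma bowen_pre_le n e m a N : (N <= n)%N ->
  (forall x y, E (n + m) x y -> dyn_dist d T n x y < e) ->
  (bowen_pre (@log_scale R) d T K a e N <=
    ((2 ^ (r * (n + m)))%:R * log_scale a (expR (- n%:R)))%:E)%E.
Proof.
move=> Nn Em; set M := (2 ^ _)%N.
pose l := (r * (n + m))%N.
(* Words are listed by natural numbers to fit the format of covers; the default is used only outside
   [I_M]. *)
pose x i := f (pad (nth (word l (fun=> false)) (enum {: l.-tuple bool}) i)).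
apply: ereal_inf_lbound; exists `I_M, x, (fun=> n); split => //.
- rewrite Kf => _ [w _ <-]; exists (enum_rank (word l w)).
    by rewrite /= /M -card_word ltn_ord.
  by apply/Em/Ef; rewrite nth_enum_rank word_pad.
- rewrite esum_fset//; last by move=> i _; rewrite lee_fin ltW// log_scale_gt0.
  by rewrite -fsbig_ord sumEFin sumr_const card_ord mulr_natl.
Qed.

(** Each ball of the cover weighs at least [c * 2 ^- (r * k i)], and Kraft's inequality bounds the
    sum of these from below by [c]. *)
Lemma bowen_pre_ge (c : R) e a N : 0 <= c -> e <= e0 ->
  (forall n, (N <= n)%N -> c <= (2 ^ (r * n))%:R * log_scale a (expR (- n%:R))) ->
  (c%:E <= bowen_pre (@log_scale R) d T K a e N)%E.
Proof.
move=> c0 ee0 Nc; apply/ereal_infP => _ [D [x [k [kN Kcov ->]]]].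
(* A ball meeting [K] does so inside one cylinder, that of [v i]; for a ball missing [K] the
   condition on [v i] is vacuous. *)
have /choice[v vP] i : exists v, forall w, dyn_dist d T (k i) (x i) (f w) < e ->
    word (r * k i) w = word (r * k i) v.
  have [[v iv]|niv] := pselect (exists v, dyn_dist d T (k i) (x i) (f v) < e).
    exists v => w iw; apply/Ef.
    by apply: Etrans (dyn_dist_itinerary ee0 iv); apply/Esym/(dyn_dist_itinerary ee0 iw).
  by exists (fun=> false) => w iw; exfalso; apply: niv; exists w.
have [|D' D'D D'1] := @kraft R D (fun i => (r * k i)%N) v.
  move=> w; have [|i Di iw] := Kcov (f w); first by rewrite Kf; exists w.
  by exists i => //; apply: vP.
apply: esum_ge; exists [set` D']; first by split.
rewrite fsbig_finite//= set_fsetK sumEFin lee_fin.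
rewrite (le_trans (ler_peMr c0 D'1))// mulr_sumr big_seq [leRHS]big_seq.
apply: ler_sum => i /D'D Di; rewrite ler_pdivrMr ?exprn_gt0//.
by rewrite mulrC -natrX Nc// kN.
Qed.

Let L : R := ln 2.
Let L_gt0 : 0 < L. Proof. by rewrite ln_gt0// ltr1n. Qed.

Let near_growth_ge a (B : R) : 0 < a -> a < (r%:R * L) ^+ 2 ->
  \forall n \near \oo, B <= (2 ^ (r * n))%:R * log_scale a (expR (- n%:R)).
Proof.
move=> a0 aL; under eq_near => n do rewrite pow2_log_scale.
apply: near_expR_linear_ge; rewrite subr_gt0 -(ltr_pXn2r (_ : (0 < 2)%N))//.
- by rewrite sqr_sqrtr// ltW.
- by rewrite nnegrE sqrtr_ge0.
- by rewrite nnegrE mulr_ge0// ltW.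
Qed.

Let near_growth_le a m (e : R) : (r%:R * L) ^+ 2 <= a -> 0 < e ->
  \forall n \near \oo,
    (2 ^ (r * (n + m)))%:R * log_scale a (expR (- n%:R)) <= e.
Proof.
move=> aL e_gt0; have rL : 0 < r%:R * L by rewrite mulr_gt0// ltr0n.
have a0 : 0 < a by apply: lt_le_trans aL; rewrite exprn_gt0.
have m0 : 0 < (2 ^ (r * m))%:R :> R by rewrite ltr0n expn_gt0.
(* The shift by [m] only contributes the constant factor [2 ^ (r * m)]. *)
near=> n; rewrite mulnDr expnD mulnC natrM -mulrA pow2_log_scale mulrC -ler_pdivlMr//.
near: n; apply: near_expR_linear_le => //; last exact: divr_gt0.
rewrite subr_le0 -(ler_pXn2r (_ : (0 < 2)%N))//.
- by rewrite sqr_sqrtr// ltW.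
- by rewrite nnegrE ltW.
- by rewrite nnegrE sqrtr_ge0.
Unshelve. all: by end_near. Qed.

Let sep_num_ge0 n e : (0 <= sep_num d T K n e)%E.
Proof.
apply: ereal_sup_ubound; exists 0%N => //=; exists set0; split => //.
by rewrite II0; exact: card_eq00.
Qed.

(** The upper limit already vanishes for every [e > 0], so the limit in [e] is that of a
    constant. *)
Lemma upper_capacity_eq0 a : (r%:R * L) ^+ 2 <= a ->
  upper_capacity (@log_scale R) d T K a = 0%E.
Proof.
move=> aL; apply: lim_near_cst; first exact: ereal_hausdorff.
near=> e; have e_gt0 : 0 < e by [].
apply: limn_esup0 => [n|c c0].
  by rewrite mule_ge0// lee_fin ltW// log_scale_gt0.
have [m mP] := itinerary_dyn_dist e_gt0.
have := near_growth_le m aL c0; apply: filterS => n; rewrite -lee_fin.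
apply: le_trans; rewrite [leRHS]EFinM; apply: lee_wpmul2r.
  by rewrite lee_fin ltW// log_scale_gt0.
exact: (sep_num_le (mP n)).
Unshelve. all: by end_near. Qed.

Lemma upper_capacity_eqy a : 0 < a -> a < (r%:R * L) ^+ 2 ->
  upper_capacity (@log_scale R) d T K a = +oo%E.
Proof.
move=> a0 aL; apply: lim_near_cst; first exact: ereal_hausdorff.
near=> e; have ee0 : e <= e0 by near: e; exact: nbhs_right_le.
apply: limn_esupy => B.
have := near_growth_ge B a0 aL; apply: filterS => n; rewrite -lee_fin.
move/le_trans; apply; rewrite [leLHS]EFinM; apply: lee_wpmul2r.
  by rewrite lee_fin ltW// log_scale_gt0.
exact: sep_num_ge.
Unshelve. all: by end_near. Qed.

Lemma bowen_measure_eq0 a : (r%:R * L) ^+ 2 <= a ->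
  bowen_measure (@log_scale R) d T K a = 0%E.
Proof.
move=> aL; apply: lim_near_cst; first exact: ereal_hausdorff.
near=> e; have e_gt0 : 0 < e by [].
apply: lim_near_cst; first exact: ereal_hausdorff.
near=> N; apply/le_anti/andP; split.
  apply/lee_addgt0Pr => c c0; rewrite add0e.
  have [m mP] := itinerary_dyn_dist e_gt0.
  (* A single time [n >= N], late enough, already gives a cover of weight at most [c]. *)
  have [n [nc Nn]] := filter_ex (filterI (near_growth_le m aL c0) (nbhs_infty_ge N)).
  by apply: le_trans (bowen_pre_le a Nn (mP n)) _; rewrite lee_fin.
apply/ereal_infP => _ [D [x [k [_ _ ->]]]].
by apply: esum_ge0 => i _; rewrite lee_fin ltW// log_scale_gt0.
Unshelve. all: by end_near. Qed.

Lemma bowen_measure_eqy a : 0 < a -> a < (r%:R * L) ^+ 2 ->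
  bowen_measure (@log_scale R) d T K a = +oo%E.
Proof.
move=> a0 aL; apply: lim_near_cst; first exact: ereal_hausdorff.
near=> e; have ee0 : e <= e0 by near: e; exact: nbhs_right_le.
apply: cvg_lim; first exact: ereal_hausdorff.
(* The absolute value provides the nonnegative bound that [bowen_pre_ge] asks for. *)
apply/cvgeyPge => B; have [N _ NP] := near_growth_ge `|B| a0 aL.
near=> M; apply: (@le_trans _ _ `|B|%:E); first by rewrite lee_fin ler_norm.
apply: bowen_pre_ge => // n Mn; apply: NP; apply: leq_trans Mn.
by near: M; exact: nbhs_infty_ge.
Unshelve. all: by end_near. Qed.

(** The infimum is attained, since the capacity vanishes at the critical exponent. *)
Lemma hC_coded : hC (@log_scale R) d T K = ((r%:R * L) ^+ 2)%:E.
Proof.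
have rL : 0 < (r%:R * L) ^+ 2 by rewrite exprn_gt0// mulr_gt0// ltr0n.
apply/le_anti/andP; split.
  apply: ereal_inf_lbound; exists ((r%:R * L) ^+ 2) => //; split => //.
  exact: upper_capacity_eq0.
apply/ereal_infP => _ [a [a0 aK] <-]; rewrite lee_fin leNgt; apply/negP => aL.
by move: aK; rewrite upper_capacity_eqy.
Qed.

Lemma hB_coded : hB (@log_scale R) d T K = ((r%:R * L) ^+ 2)%:E.
Proof.
have rL : 0 < (r%:R * L) ^+ 2 by rewrite exprn_gt0// mulr_gt0// ltr0n.
apply/le_anti/andP; split.
  apply/ereal_supP => _ [->|[a [a0 aK] <-]]; first by rewrite lee_fin ltW.
  rewrite lee_fin leNgt; apply/negP => aL.
  by move: aK; rewrite bowen_measure_eq0// ltW.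
apply/lee_subgt0Pr => c c0; rewrite -EFinB.
(* The critical exponent is only approached from below, by subtracting [c]; if [c] is too large, the
   adjoined 0 suffices. *)
have [cL|Lc] := ltP c ((r%:R * L) ^+ 2); last first.
  apply: (@le_trans _ _ 0%E); first by rewrite lee_fin subr_le0.
  by apply: ereal_sup_ubound; left.
apply: ereal_sup_ubound; right; exists ((r%:R * L) ^+ 2 - c) => //.
have cL0 : 0 < (r%:R * L) ^+ 2 - c by rewrite subr_gt0.
by split => //; apply: bowen_measure_eqy => //; rewrite gtrBl.
Qed.

Lemma hU_top_coded : hU_top d T K = (r%:R * L)%:E.
Proof.
have lne2 k : lne ((2 ^ k)%:R%:E : \bar R) = (k%:R * L)%:E.
  by rewrite lne_EFin ?ltr0n ?expn_gt0// natrX lnXn// mulr_natl.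
have lne_le (x y : \bar R) : (0 <= x)%E -> (x <= y)%E -> (lne x <= lne y)%E.
  by move=> x0 xy; rewrite lee_lne// in_itv/= leey andbT// (le_trans x0).
have fin0 k : (0 <= (2 ^ k)%:R%:E :> \bar R)%E by rewrite lee_fin.
apply: lim_near_cst; first exact: ereal_hausdorff.
near=> e; have e_gt0 : 0 < e by [].
have ee0 : e <= e0 by near: e; exact: nbhs_right_le.
have [m mP] := itinerary_dyn_dist e_gt0.
have span_ge0 n : (0 <= span_num d T K n e)%E.
  exact: le_trans (span_num_ge n ee0).
apply/le_anti/andP; split.
  apply/lee_addgt0Pr => c c0; apply: limn_esup_le_near; near=> n.
  have n0 : 0 < n%:R :> R by rewrite ltr0n; near: n; exact: nbhs_infty_gt.
  have h := lne_le _ _ (span_ge0 n) (span_num_le (mP n)).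
  apply: le_trans (lee_wpmul2l _ h) _; first by rewrite lee_fin invr_ge0 ltW.
  rewrite lne2 -EFinM -EFinD lee_fin ler_pdivrMl// natrM natrD.
  (* From here on, the excess [r * m * L / n] due to the longer cylinders is at most [c]. *)
  have : (r%:R * m%:R * L) / c <= n%:R by near: n; exact: nbhs_infty_ger.
  by rewrite ler_pdivrMr//; lra.
apply: limn_esup_ge_near; near=> n.
have n0 : 0 < n%:R :> R by rewrite ltr0n; near: n; exact: nbhs_infty_gt.
have h := lne_le _ _ (fin0 _) (span_num_ge n ee0).
 apply: le_trans (lee_wpmul2l _ h); last by rewrite lee_fin invr_ge0 ltW.
by rewrite lne2 -EFinM lee_fin natrM -mulrA mulrCA mulKf// gt_eqF.
Unshelve. all: by end_near. Qed.

End coded_system.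

(** * The function Gamma for the logarithmic scale *)

Lemma Gamma_log_scale (R : realType) (u a : R) : 0 <= u -> 0 <= a ->
  Gamma (@log_scale R) u a = ((Num.sqrt u + a) ^+ 2)%:E.
Proof.
move=> u0 a0; have su0 := sqrtr_ge0 u.
have ratioE (b t s : R) (n : nat) :
    expR ((a + t) * n%:R) * log_scale b (expR (- n%:R)) /
      log_scale s (expR (- n%:R)) =
    expR ((a + t - Num.sqrt b + Num.sqrt s) * n%:R - (b - s) * ln (1 + n%:R)).
  by rewrite !log_scale_expRN -expRN -!expRD; congr expR; ring.
apply/le_anti/andP; split; last first.
  apply/ereal_infP => _ [b [b0 [s [t [us t0 +]]]] <-].
  under eq_fun do rewrite ratioE.
  (* Below the claimed value the linear coefficient is positive for all admissible [s] and [t], and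
     the ratio diverges. *)
  rewrite lee_fin; apply: contraTT; rewrite -ltNge => bu; rewrite limn_esupy// => A.
  apply: near_expR_linear_ge.
  have : Num.sqrt u < Num.sqrt s by rewrite ltr_sqrt// (le_lt_trans u0).
  suff : Num.sqrt b < Num.sqrt u + a by lra.
  by rewrite -(ltr_pXn2r (_ : (0 < 2)%N))// ?sqr_sqrtr ?nnegrE ?sqrtr_ge0 ?addr_ge0// ltW.
apply/lee_addgt0Pr => c c0; rewrite -EFinD.
apply: ereal_inf_lbound; exists ((Num.sqrt u + a) ^+ 2 + c) => //.
set b := _ + c; have b0 : 0 < b by rewrite ltr_wpDl// sqr_ge0.
have ub : Num.sqrt u + a < Num.sqrt b.
  rewrite -(ltr_pXn2r (_ : (0 < 2)%N))// ?nnegrE ?sqrtr_ge0 ?addr_ge0//.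
  by rewrite sqr_sqrtr ?ltrDl// ltW.
(* A third of the slack goes to tau, a third to the square root of alpha, and the linear coefficient
   is left equal to [- t]. *)
pose t := (Num.sqrt b - Num.sqrt u - a) / 3.
have t0 : 0 < t by rewrite /t; lra.
have sb : Num.sqrt u + t <= Num.sqrt b by rewrite /t; lra.
split => //; exists ((Num.sqrt u + t) ^+ 2), t; split => //.
  rewrite -{1}(sqr_sqrtr u0) ltr_pXn2r ?nnegrE// ?ltrDl// addr_ge0// ltW//.
under eq_fun do rewrite ratioE.
apply: (@le_lt_trans _ _ 1%:E); last exact: ltry.
(* Since also [s <= b], both terms of the exponent have the right sign and the ratio is at most 1
   for every [n]. *)
apply: limn_esup_le_near; apply: nearW => n; rewrite lee_fin -[leRHS]expR0 ler_expR.
rewrite sqrtr_sqr ger0_norm; last by rewrite addr_ge0// ltW.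
have l0 : 0 <= ln (1 + n%:R) :> R by rewrite ln_ge0// lerDl.
rewrite subr_le0; apply: (@le_trans _ _ 0).
  by rewrite mulr_le0_ge0//; rewrite /t; lra.
rewrite mulr_ge0// subr_ge0 -(sqr_sqrtr (ltW b0)) ler_pXn2r ?nnegrE ?sqrtr_ge0//.
by rewrite addr_ge0// ltW.
Qed.

(** * Codings of the full shift and of its product *)

Lemma same_itinerary_sigma (n : nat) (w w' : Sigma2) :
  same_itinerary (fun w : Sigma2 => w 0%N) sigma n w w' <->
  word n w = word n w'.
Proof.
have iterE j (v : Sigma2) i : iter j sigma v i = v (j + i)%N.
  by elim: j i => //= j IH i; rewrite /sigma IH addSnnS.
rewrite wordP; split=> ww' j jn; first by have := ww' j jn; rewrite !iterE addn0.
by rewrite !iterE addn0 ww'.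
Qed.

Definition first_symbols (x : Sigma2 * Sigma2) : bool * bool := (x.1 0%N, x.2 0%N).

Lemma same_itinerary_sigma_sigma (n : nat) (x y : Sigma2 * Sigma2) :
  same_itinerary first_symbols sigma_sigma n x y <->
  word n x.1 = word n y.1 /\ word n x.2 = word n y.2.
Proof.
have iterE j v : iter j sigma_sigma v = (iter j sigma v.1, iter j sigma v.2).
  by elim: j => [|j /= ->]; [case: v|].
rewrite -!same_itinerary_sigma; split=> [xy|[xy1 xy2] j jn].
  by split=> j jn; have := xy j jn; rewrite !iterE => -[].
by rewrite !iterE /first_symbols /= xy1// xy2.
Qed.

Lemma Sigma2_metric (R : realType) (d : Sigma2 -> Sigma2 -> R) :
  compatible_metric d ->
  (exists2 e, 0 < e & forall w w', d w w' < e -> w 0%N = w' 0%N) /\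
  (forall e, 0 < e -> exists m, forall w w', word m w = word m w' -> d w w' < e).
Proof.
move=> dP; pose E n w w' := word n w = word n w'.
have Etrans n x y z : E n x y -> E n y z -> E n x z by exact: etrans.
have Enear n x : \forall y \near x, E n x y.
  by have := near_word n x; apply: filterS.
split.
  have [e e0 eP] := @metric_refines R cantor_space d E cantor_space_compact dP
    (fun _ _ _ => @esym _ _ _) Etrans Enear 1.
  by exists e => // w w' /eP /wordP; apply.
move=> e e0; apply: (@metric_refined R cantor_space d E cantor_space_compact dP
  Etrans _ Enear _ e e0).
  by move=> m n x y mn /wordP xy; apply/wordP => i im; apply/xy/(leq_trans im).
by move=> x U /nbhs_word[n nU]; exists n => y xy; apply: nU.
Qed.

(* The pointed topological structure on products, needed for [compact_cover]. *)
HB.saturate prod.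

Lemma Sigma2X_metric (R : realType) (d : Sigma2 * Sigma2 -> Sigma2 * Sigma2 -> R) :
  compatible_metric d ->
  (exists2 e, 0 < e & forall x y, d x y < e -> first_symbols x = first_symbols y) /\
  (forall e, 0 < e -> exists m, forall x y,
     word m x.1 = word m y.1 /\ word m x.2 = word m y.2 -> d x y < e).
Proof.
move=> dP; pose E n (x y : Sigma2 * Sigma2) :=
  word n x.1 = word n y.1 /\ word n x.2 = word n y.2.
have cX : compact [set: cantor_space * cantor_space].
  by rewrite -setXTT; apply: compact_setX; exact: cantor_space_compact.
have Esym n x y : E n x y -> E n y x by move=> [? ?]; split.
have Etrans n x y z : E n x y -> E n y z -> E n x z.
  by move=> [xy1 xy2] [yz1 yz2]; split; [exact: etrans yz1|exact: etrans yz2].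
have Enear n x : \forall y \near x, E n x y.
  exists ([set w | word n w = word n x.1], [set w | word n w = word n x.2]).
    by split; exact: near_word.
  by move=> y /= [].
split.
  have [e e0 eP] := @metric_refines R (cantor_space * cantor_space)%type d E cX dP
    Esym Etrans Enear 1.
  exists e => // x y /eP[/wordP xy1 /wordP xy2].
  by rewrite /first_symbols xy1// xy2.
move=> e e0; apply: (@metric_refined R (cantor_space * cantor_space)%type d E cX dP
  Etrans _ Enear _ e e0).
  move=> m n x y mn [/wordP xy1 /wordP xy2].
  by split; apply/wordP => i im; [apply/xy1|apply/xy2]; apply: (leq_trans im).
move=> x U [[V W] /= [/nbhs_word[n nV] /nbhs_word[m mW]] VWU].
exists (maxn n m) => y [/wordP xy1 /wordP xy2]; apply: VWU; split => /=.
  by apply/nV/wordP => i im; rewrite xy1// leq_max im.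
by apply/mW/wordP => i im; rewrite xy2// leq_max im orbT.
Qed.

(** Bits [2 i] and [2 i + 1] are the two symbols at time [i], so that [n] symbols of the pair use
    exactly the first [2 n] bits. *)
Definition interlace (w : Sigma2) : Sigma2 * Sigma2 :=
  ((fun i => w i.*2) : Sigma2, (fun i => w i.*2.+1) : Sigma2).

Lemma range_interlace : range interlace = [set: Sigma2 * Sigma2].
Proof.
apply/seteqP; split => // -[u v] _.
exists (fun i => if odd i then v i./2 else u i./2) => //.
congr pair; apply/funext => i /=; first by rewrite odd_double doubleK.
by rewrite odd_double/= uphalf_double.
Qed.

Lemma word_interlace (n : nat) (w w' : Sigma2) :
  (word n (interlace w).1 = word n (interlace w').1 /\
   word n (interlace w).2 = word n (interlace w').2) <->
  word (2 * n) w = word (2 * n) w'.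
Proof.
rewrite !wordP mul2n; split=> [[e o] i i2n|ww'].
  rewrite -(odd_double_half i); have i2 : (i./2 < n)%N by rewrite ltn_half_double.
  by case: (odd i); [exact: o|exact: e].
by split=> i ni; apply: ww'; lia.
Qed.

(** * Entropy scales of the product, the base and the fibers *)

Theorem corollary4p6 (R : realType)
    (dX : (Sigma2 * Sigma2)%type -> (Sigma2 * Sigma2)%type -> R)
    (dY : Sigma2 -> Sigma2 -> R)
    (compat_dX : compatible_metric dX) (compat_dY : compatible_metric dY) :
  let scl : R -> R -> R := @log_scale R in
  let T := sigma_sigma in
  let S := sigma in
  let p : Sigma2 * Sigma2 -> Sigma2 := fst in
  let hC_X := hC scl dX T [set: Sigma2 * Sigma2] in
  let hB_X := hB scl dX T [set: Sigma2 * Sigma2] in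
  let hC_Y := hC scl dY S [set: Sigma2] in
  let hB_Y := hB scl dY S [set: Sigma2] in
  let hC_fiber := fun y : Sigma2 => hC scl dX T (fiber p y) in
  let hB_fiber := fun y : Sigma2 => hB scl dX T (fiber p y) in
  let a_p := fiber_entropy dX T p in
  (hC_X = (4 * ln 2 ^+ 2)%:E /\ hB_X = (4 * ln 2 ^+ 2)%:E) /\
  (hC_Y = (ln 2 ^+ 2)%:E /\ hB_Y = (ln 2 ^+ 2)%:E) /\
  (forall y : Sigma2,
     hC_fiber y = (ln 2 ^+ 2)%:E /\ hB_fiber y = (ln 2 ^+ 2)%:E) /\
  ~ (hC_X <= hC_Y + ereal_sup (range hC_fiber))%E /\
  ~ (hB_X <= hB_Y + ereal_sup (range hB_fiber))%E /\
  (exists u a : R, [/\ 0 <= u, 0 <= a, hC_Y = u%:E, a_p = a%:E &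
     hC_X = Gamma scl u a]) /\
  (exists u a : R, [/\ 0 <= u, 0 <= a, hB_Y = u%:E, a_p = a%:E &
     hB_X = Gamma scl u a]).
Proof.
move=> scl T S p hC_X hB_X hC_Y hB_Y hC_fiber hB_fiber a_p.
pose L : R := ln 2; have L0 : 0 < L by rewrite ln_gt0// ltr1n.
have [[eX eX0 dXg] gdX] := Sigma2X_metric compat_dX.
have [[eY eY0 dYg] gdY] := Sigma2_metric compat_dY.
have {}gdX e : 0 < e -> exists m, forall x y,
    same_itinerary first_symbols sigma_sigma m x y -> dX x y < e.
  by move=> /gdX[m mP]; exists m => x y /same_itinerary_sigma_sigma/mP.
have {}gdY e : 0 < e -> exists m, forall x y,
    same_itinerary (fun w : Sigma2 => w 0%N) sigma m x y -> dY x y < e.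
  by move=> /gdY[m mP]; exists m => x y /same_itinerary_sigma/mP.
(* Three codings: [interlace] for the product with [r = 2], the identity for the base and [pair y]
   for the fiber over [y] with [r = 1]. *)
have fX n w w' : same_itinerary first_symbols sigma_sigma n (interlace w) (interlace w')
    <-> word (2 * n) w = word (2 * n) w'.
  by rewrite same_itinerary_sigma_sigma word_interlace.
have fY n w w' : same_itinerary (fun w : Sigma2 => w 0%N) sigma n w w'
    <-> word (1 * n) w = word (1 * n) w'.
  by rewrite mul1n same_itinerary_sigma.
have fF y n w w' : same_itinerary first_symbols sigma_sigma n (y, w) (y, w')
    <-> word (1 * n) w = word (1 * n) w'.
  by rewrite mul1n same_itinerary_sigma_sigma/=; split=> [[]|].
have rY : [set: Sigma2] = range id by rewrite image_id.
have rF y : fiber p y = range (pair y).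
  apply/seteqP; split => [[u v] uy|_ [v _ <-]//].
  by exists v; rewrite // -(uy : u = y).
have L4 : (2%:R * L) ^+ 2 = 4 * L ^+ 2 by ring.
have L1 : (1%:R * L) ^+ 2 = L ^+ 2 by rewrite mul1r.
have hCX : hC_X = (4 * L ^+ 2)%:E.
  by rewrite -L4; apply: (hC_coded eX0 dXg gdX _ (esym range_interlace) fX).
have hBX : hB_X = (4 * L ^+ 2)%:E.
  by rewrite -L4; apply: (hB_coded eX0 dXg gdX _ (esym range_interlace) fX).
have hCY : hC_Y = (L ^+ 2)%:E.
  by rewrite -L1; apply: (hC_coded eY0 dYg gdY _ rY fY).
have hBY : hB_Y = (L ^+ 2)%:E.
  by rewrite -L1; apply: (hB_coded eY0 dYg gdY _ rY fY).
have hCF y : hC_fiber y = (L ^+ 2)%:E.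
  by rewrite -L1; apply: (hC_coded eX0 dXg gdX _ (rF y) (fF y)).
have hBF y : hB_fiber y = (L ^+ 2)%:E.
  by rewrite -L1; apply: (hB_coded eX0 dXg gdX _ (rF y) (fF y)).
have supE (h : Sigma2 -> \bar R) c : (forall y, h y = c) ->
    ereal_sup [set h y | y in [set: Sigma2]] = c.
  move=> hc; rewrite (_ : h = cst c); last exact/funext.
  by apply: ereal_sup_cst; apply/set0P; exists (fun=> false).
have apE : a_p = L%:E.
  apply: supE => y; rewrite -[L]mul1r.
  exact: (hU_top_coded eX0 dXg gdX (rF y) (fF y)).
(* The square root of [L ^+ 2] is [L], so the value is [(L + L) ^+ 2], which matches the product. *)
have GammaE : Gamma scl (L ^+ 2) L = (4 * L ^+ 2)%:E.
  rewrite Gamma_log_scale ?sqr_ge0 1?ltW// sqrtr_sqr gtr0_norm// -L4.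
  by congr (_ ^+ 2)%:E; ring.
have not_add : ~ ((4 * L ^+ 2)%:E <= (L ^+ 2)%:E + (L ^+ 2)%:E)%E.
  apply/negP; rewrite -ltNge -EFinD lte_fin.
  have := exprn_gt0 2 L0; lra.
rewrite hCX hBX hCY hBY (supE _ _ hCF) (supE _ _ hBF).
have u0 : 0 <= L ^+ 2 by rewrite sqr_ge0.
split; first by split.
split; first by split.
split; first by move=> y; split; [exact: hCF|exact: hBF].
split; first exact: not_add.
split; first exact: not_add.
by split; exists (L ^+ 2), L; split; rewrite ?GammaE ?apE// ltW.
Qed.
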